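(* Let $X$ be a real Banach space and let $\kappa$ be an infinite cardinal. Assume that $X$ is $(\ell_\infty(\omega_0),\kappa)$-octahedral. Let $\mathcal U$ be any countably incomplete ultrafilter over any infinite set $I$. Then the ultrapower $X_{\mathcal U}$ is $(\ell_\infty(\omega_1),\kappa)$-rigid octahedral.
   Context: For a cardinal $\alpha'$, $\ell_\infty(\alpha')$ is the space of bounded real functions on a set of cardinality $\alpha'$ with the supremum norm. For infinite cardinals $\alpha,\beta$, a Banach space $X$ is $(\ell_\infty(\alpha),\beta)$-octahedral if for every subset $Z\subseteq X$ with $|Z|<\beta$, every cardinal $\alpha'<\alpha$ and every $\varepsilon>0$ there exists a bounded linear operator $\phi:\ell_\infty(\alpha')\longrightarrow X$ with $\Vert\phi\Vert\leq 1$ such that $\Vert z+\phi(y)\Vert\geq (1-\varepsilon)(\Vert z\Vert+\Vert y\Vert)$ for every $z\in Z$ and $y\in\ell_\infty(\alpha')$. It is $(\ell_\infty(\alpha),\beta)$-rigid octahedral if the same condition holds with $\varepsilon=0$ (so that $\Vert z+\phi(y)\Vert=\Vert z\Vert+\Vert y\Vert$ for every $z\in Z$, $y\in\ell_\infty(\alpha')$). An ultrafilter $\mathcal U$ over $I$ is countably incomplete if there is a sequence $(A_n)$ in $\mathcal U$ with $\bigcap_n A_n=\emptyset$ (such an ultrafilter is free). The ultrapower is $X_{\mathcal U}:=\ell_\infty(I,X)/N_{\mathcal U}$, where $\ell_\infty(I,X)$ is the space of bounded functions $f:I\to X$ with the supremum norm and $N_{\mathcal U}=\{f:\lim_{\mathcal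 U}\Vert f(i)\Vert=0\}$; its quotient norm is $\Vert [x_i]_{\mathcal U}\Vert=\lim_{\mathcal U}\Vert x_i\Vert$. *)

(* Defs.v *)
From HB Require Import structures.
From mathcomp Require Import all_boot all_order all_algebra ring_quotient.
From mathcomp Require Import all_classical all_reals all_analysis.
From mathcomp Require wochoice.

Set Implicit Arguments.
Unset Strict Implicit.
Unset Printing Implicit Defensive.

Import Order.TTheory GRing.Theory Num.Theory.
Import numFieldNormedType.Exports.

Local Open Scope classical_set_scope.
Local Open Scope card_scope.
Local Open Scope ring_scope.

(* Cardinals are represented by types up to equipotence. *)
Definition card_lt (A B : Type) : Prop :=
  ([set: A] #<= [set: B]) /\ ~ ([set: B] #<= [set: A]).

Definition is_succ_card (A B : Type) : Prop :=
  card_lt A B /\ forall T : Type, card_lt A T -> [set: B] #<= [set: T].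

Lemma exists_strict_well_order (T : Type) : exists lt : T -> T -> Prop,
  (forall A : set T, A !=set0 ->
    exists2 x, A x & forall y, lt y x -> ~ A y) /\
  (forall x y, x <> y -> lt x y \/ lt y x).
Proof.
have [R Rwo] := wochoice.well_ordering_principle {classic T}.
have Rmin (A : set T) : A !=set0 ->
    exists2 x, A x & forall y, A y -> R x y /\
    ((forall z, A z -> R y z) -> x = y).
  move=> [a Aa]; have [|x [[xA xmin] xU]] := Rwo (fun x => `[< A x >]).
    by exists a; apply/asboolP.
  exists x; first exact/asboolP.
  move=> y Ay; split; first by apply: xmin; apply/asboolP.
  move=> ymin; apply: xU; split; first exact/asboolP.
  by move=> z /asboolP; exact: ymin.
have Rr x : R x x.
  by have [|y -> /(_ x erefl)[]//] := Rmin [set x]; exists x.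
exists (fun x y => R x y /\ x <> y); split.
  move=> A A0; have [x Ax xmin] := Rmin A A0.
  exists x => // y [Ryx yx] Ay; apply: yx.
  have Rxy : R x y by have [] := xmin _ Ay.
  have [|z zxy zmin] := Rmin [set x; y]; first by exists x; left.
  rewrite -((zmin x (or_introl erefl)).2); last by move=> w [->|->].
  rewrite -((zmin y (or_intror erefl)).2)//; last by move=> w [->|->].
move=> x y xy; have [|z [->|->] zmin] := Rmin [set x; y].
- by exists x; left.
- by left; split=> //; have [] := zmin y (or_intror erefl).
- by right; split=> [|/esym//]; have [] := zmin x (or_introl erefl).
Qed.

Lemma exists_omega1 : exists W : Type, is_succ_card nat W.
Proof.
have [lt [lt_min lt_total]] := exists_strict_well_order (set nat).
pose seg x := [set y | lt y x].
have lt_wf : well_founded lt.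
  move=> a; apply: contrapT => aN.
  have [x xN xmin] := lt_min [set x | ~ Acc lt x] (ex_intro _ a aN).
  by apply: xN; constructor => y /xmin /contrapT.
have [W [WN Wseg]] : exists W : set (set nat), ~ countable W /\
    forall x, W x -> countable (seg x `&` W).
  have [[a aN]|H] := pselect (exists x, ~ countable (seg x)).
    have [x xN xmin] := lt_min [set x | ~ countable (seg x)] (ex_intro _ a aN).
    exists (seg x); split=> // y /xmin /contrapT yC.
    by apply: sub_countable yC; apply: subset_card_le => z [].
  exists setT; split; last first.
    by move=> x _; rewrite setIT; apply: contrapT => xN; apply: H; exists x.
  move=> /pcard_surjP[f fS].
  have [n _ fn] := fS [set k | ~ f k k] I.
  have : f n n <-> ~ f n n by rewrite {1}fn.
  tauto.
have ltW0 : card_lt nat W.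
  rewrite /card_lt !(card_le_eql (card_setT W), card_le_eqr (card_setT W)).
  by split=> //; apply/infiniteP => /finite_set_countable.
exists W; split=> // T [natT NT]; rewrite (card_le_eql (card_setT W)).
have [t0 _] : [set: T] !=set0.
  by apply/set0P/eqP => T0; apply: NT; rewrite T0 card_ge0.
pose next x (g : forall y, lt y x -> T) : T :=
  xget (t0 : {classic T}) [set t | forall y (h : lt y x), W y -> g y h <> t].
pose f := Fix lt_wf (fun=> T) next.
have fE x : f x = next x (fun y _ => f y).
  apply: Fix_eq => {}x g h gh; congr next.
  by apply/functional_extensionality_dep => y; apply/funext.
have f_neq x y : W x -> W y -> lt y x -> f y <> f x.
  move=> Wx Wy yx; rewrite (fE x) /next.
  case: xgetP => [t _ /(_ y yx Wy)//|noT].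
  exfalso; apply: NT.
  apply: (card_le_trans _ (Wseg x Wx)).
  apply: (card_le_trans _ (card_image_le f _)).
  apply: subset_card_le => t _; apply: contrapT => tN; apply: (noT t) => /=.
  by move=> z zx Wz fzt; apply: tN; exists z.
have /injfunPex[F] : exists2 f : set nat -> T, set_fun W [set: T] f & set_inj W f.
  exists f => // x y; rewrite !inE => Wx Wy fxy.
  by apply: contrapT => /lt_total[] h;
    [exact: (f_neq _ _ Wy Wx h)|exact: (f_neq _ _ Wx Wy h)].
exact: inj_card_le F.
Qed.

(* The cardinal omega_1, i.e. the successor of omega_0; the defining property
   determines it up to equipotence. *)
Definition omega1 : Type := projT1 (cid exists_omega1).

Lemma omega1P : is_succ_card nat omega1.
Proof. exact: projT2 (cid exists_omega1). Qed.

Section Linfty.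
Context {R : realType} (S : Type) (V : normedModType R).

Definition bounded_pred : {pred S -> V} :=
  fun f => `[< bounded_fun f >].

Record linfty := Linfty {
  linfty_fun :> S -> V ;
  _ : linfty_fun \in bounded_pred }.

Lemma bounded_predP (f : S -> V) :
  f \in bounded_pred <-> exists M, forall s, `|f s| <= M.
Proof.
rewrite unfold_in; split=> [/asboolP[M [_ Mf]]|[M Mf]].
  by exists (M + 1) => s; apply: Mf; rewrite ?ltrDl.
apply/asboolP; exists M; split=> [|N MN s _]; first exact: num_real.
exact: le_trans (Mf s) (ltW MN).
Qed.

Fact bounded_pred_submod : submod_closed bounded_pred.
Proof.
split; first by apply/bounded_predP; exists 0 => s; rewrite normr0.
move=> k f g /bounded_predP[M Mf] /bounded_predP[N Ng].
apply/bounded_predP; exists (`|k| * M + N) => s.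
by rewrite (le_trans (ler_normD _ _))// lerD// normrZ ler_wpM2l.
Qed.

HB.instance Definition _ :=
  GRing.isSubmodClosed.Build R (S -> V) bounded_pred bounded_pred_submod.
HB.instance Definition _ := [isSub for linfty_fun].
HB.instance Definition _ := [Choice of linfty by <:].
HB.instance Definition _ := [SubChoice_isSubLmodule of linfty by <:].

Definition linfty_norm (f : linfty) : R := sup (range (fun s => `|f s|)).

Lemma linfty_norm_ub (f : linfty) s : `|f s| <= linfty_norm f.
Proof.
have /bounded_predP[M Mf] := valP f.
by apply: ub_le_sup; [exists M => _ [t _ <-]|exists s].
Qed.

Lemma linfty_norm_ge0 (f : linfty) : 0 <= linfty_norm f.
Proof.
have [[s _]|S0] := pselect ([set: S] !=set0).
  exact: le_trans (normr_ge0 _) (linfty_norm_ub f s).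
rewrite /linfty_norm; have -> : range (fun s => `|f s|) = set0.
  by apply/seteqP; split=> // r [s]; case: S0; exists s.
by rewrite sup0.
Qed.

Lemma linfty_norm_le (f : linfty) (M : R) :
  0 <= M -> (forall s, `|f s| <= M) -> linfty_norm f <= M.
Proof.
move=> M0 fM; have [[s _]|S0] := pselect ([set: S] !=set0).
  by apply: ge_sup => [|_ [t _ <-]//]; exists `|f s|; exists s.
rewrite /linfty_norm; have -> : range (fun s => `|f s|) = set0.
  by apply/seteqP; split=> // r [s]; case: S0; exists s.
by rewrite sup0.
Qed.

Fact linfty_normD f g : linfty_norm (f + g) <= linfty_norm f + linfty_norm g.
Proof.
apply: linfty_norm_le => [|s]; first by rewrite addr_ge0 ?linfty_norm_ge0.
by rewrite (le_trans (ler_normD _ _))// lerD ?linfty_norm_ub.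
Qed.

Fact linfty_normZ (k : R) f : linfty_norm (k *: f) = `|k| * linfty_norm f.
Proof.
have leZ (l : R) g : linfty_norm (l *: g) <= `|l| * linfty_norm g.
  apply: linfty_norm_le => [|s]; first by rewrite mulr_ge0 ?linfty_norm_ge0.
  by rewrite normrZ ler_wpM2l ?linfty_norm_ub.
apply/eqP; rewrite eq_le leZ/=; have [->|k0] := eqVneq k 0.
  by rewrite normr0 mul0r linfty_norm_ge0.
rewrite -ler_pdivlMl ?normr_gt0// -normfV.
by have := leZ k^-1 (k *: f); rewrite scalerA mulVf// scale1r.
Qed.

Fact linfty_norm_eq0 f : linfty_norm f = 0 -> f = 0.
Proof.
move=> f0; apply/val_inj/funext => s; apply/eqP.
by rewrite -normr_le0 -f0; exact: linfty_norm_ub.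
Qed.

HB.instance Definition _ := Lmodule_isNormed.Build R linfty
  linfty_normD linfty_normZ linfty_norm_eq0.

Lemma linfty_normE (f : linfty) : `|f| = sup (range (fun s => `|f s|)).
Proof. by []. Qed.

End Linfty.

(* Infinite exactly when the operator is unbounded. *)
Definition opnorm {R : realType} {V W : normedModType R}
    (phi : {linear V -> W}) : \bar R :=
  ereal_sup [set `|phi x|%:E | x in [set x : V | `|x| <= 1]].

Section Ultrapower.
Context {R : realType} (X : normedModType R) {I : Type} {U : set_system I}.

(* The subspace N_U. The argument [UU] is not used in the body: it lets
   canonical structure inference recover the proof that U is an ultrafilter. *)
Definition null_pred (UU : UltraFilter U) : {pred linfty I X} :=
  fun f => `[< `|f i| @[i --> U] --> (0 : R) >].

Context (UU : UltraFilter U).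

Lemma null_predP f :
  f \in null_pred UU <-> `|f i| @[i --> U] --> (0 : R).
Proof. by rewrite unfold_in; split=> /asboolP. Qed.

Fact null_pred_zmod : zmod_closed (null_pred UU).
Proof.
split; first by apply/null_predP; under eq_fun do rewrite normr0; exact: cvg_cst.
move=> f g /null_predP f0 /null_predP g0; apply/null_predP.
apply: (@squeeze_cvgr _ _ _ _ (cst 0) (fun i => `|f i| + `|g i|)).
- by apply: nearW => i; rewrite normr_ge0/= ler_normB.
- exact: cvg_cst.
- by rewrite -[X in _ --> X]addr0; exact: cvgD.
Qed.

HB.instance Definition _ :=
  GRing.isZmodClosed.Build (linfty I X) (null_pred UU) null_pred_zmod.

Definition ultrapower := Quotient.quot (null_pred UU).

HB.instance Definition _ := GRing.Zmodule.on ultrapower.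
HB.instance Definition _ : EqQuotient _ (Quotient.equiv (null_pred UU)) ultrapower
  := EqQuotient.on ultrapower.

Definition ultra_class (f : linfty I X) : ultrapower := \pi_ultrapower%qT f.

Lemma ultra_classP f g :
  ultra_class f = ultra_class g <-> f - g \in null_pred UU.
Proof. by rewrite Quotient.idealrBE; split=> /eqP. Qed.

Lemma ultra_norm_cvg (f : linfty I X) : cvg (`|f i| @[i --> U]).
Proof.
have [|p [_ pP]] :=
    @segment_compact R 0 (linfty_norm f) (`|f i| @[i --> U]) _.
  apply: nearW => i /=.
  by rewrite in_itv/= normr_ge0 linfty_norm_ub.
apply: (@cvgP _ _ p) => N pN.
have [//|UN] := in_ultra_setVsetC ((fun i => `|f i|) @^-1` N) UU.
have [|q [qN]] := pP (~` N) N _ pN; last by [].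
exact: UN.
Qed.

Definition ultra_scale (k : R) (x : ultrapower) : ultrapower :=
  ultra_class (k *: repr x).

Lemma ultra_repr_sub f : f - repr (ultra_class f) \in null_pred UU.
Proof. by apply/ultra_classP; rewrite /ultra_class reprK. Qed.

Fact ultra_scaleE k f : ultra_scale k (ultra_class f) = ultra_class (k *: f).
Proof.
apply/esym/ultra_classP; rewrite -scalerBr; apply/null_predP.
have /null_predP f0 := ultra_repr_sub f.
have kf0 : `|k| * `|(f - repr (ultra_class f)) i| @[i --> U] --> (0 : R).
  by rewrite -[X in _ --> X](mulr0 `|k|); exact: cvgMl_tmp.
by under eq_fun do rewrite normrZ; exact: kf0.
Qed.

Fact ultra_scaleA a b x : ultra_scale a (ultra_scale b x) = ultra_scale (a * b) x.
Proof. by rewrite {2}/ultra_scale ultra_scaleE scalerA. Qed.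

Fact ultra_scale1 : left_id 1 ultra_scale.
Proof. by move=> x; rewrite /ultra_scale scale1r /ultra_class reprK. Qed.

Lemma ultra_classD f g : ultra_class (f + g) = ultra_class f + ultra_class g.
Proof. by rewrite /ultra_class !piE. Qed.

Fact ultra_scaleDr : right_distributive ultra_scale +%R.
Proof.
move=> k x y; rewrite -[x]reprK -[y]reprK -!/(ultra_class _) -ultra_classD.
by rewrite !ultra_scaleE scalerDr ultra_classD.
Qed.

Fact ultra_scaleDl x : {morph ultra_scale^~ x : a b / a + b}.
Proof. by move=> a b; rewrite /ultra_scale scalerDl ultra_classD. Qed.

HB.instance Definition _ := GRing.Zmodule_isLmodule.Build R ultrapower
  ultra_scaleA ultra_scale1 ultra_scaleDr ultra_scaleDl.

Definition ultra_norm (x : ultrapower) : R := lim (`|repr x i| @[i --> U]).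

Lemma ultra_normE f : ultra_norm (ultra_class f) = lim (`|f i| @[i --> U]).
Proof.
apply/esym/cvg_lim => //.
rewrite /ultra_norm; pose g : linfty I X := repr (ultra_class f).
have /null_predP fg : f - g \in null_pred UU := ultra_repr_sub f.
have gl := @ultra_norm_cvg g; rewrite -/g.
apply: (@squeeze_cvgr _ _ _ _ (fun i => `|g i| - `|(f - g) i|)
  (fun i => `|g i| + `|(f - g) i|)).
- apply: nearW => i; rewrite (_ : (f - g) i = f i - g i)//.
  apply/andP; split.
    by rewrite lerBlDr distrC -{1}(subrKC (f i) (g i)) ler_normD.
  by rewrite -{1}(subrKC (g i) (f i)) ler_normD.
- by rewrite -[X in _ --> X]subr0; exact: cvgB.
- by rewrite -[X in _ --> X]addr0; exact: cvgD.
Qed.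

Fact ultra_normD x y : ultra_norm (x + y) <= ultra_norm x + ultra_norm y.
Proof.
rewrite -[x]reprK -[y]reprK -!/(ultra_class _) -ultra_classD !ultra_normE.
rewrite -limD; [|exact: ultra_norm_cvg..].
rewrite -subr_ge0 -limB; [|by apply: is_cvgD; exact: ultra_norm_cvg|
  exact: ultra_norm_cvg].
apply: limr_ge.
  by apply: is_cvgB; [apply: is_cvgD|]; exact: ultra_norm_cvg.
by apply: nearW => i; rewrite subr_ge0; exact: ler_normD.
Qed.

Fact ultra_normZ (k : R) x : ultra_norm (ultra_scale k x) = `|k| * ultra_norm x.
Proof.
rewrite ultra_normE; under eq_fun do rewrite normrZ.
by apply: cvg_lim => //; apply: cvgMl_tmp; exact: ultra_norm_cvg.
Qed.

Fact ultra_norm_eq0 x : ultra_norm x = 0 -> x = 0.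
Proof.
move=> x0; rewrite -[x]reprK.
have -> : (0 : ultrapower) = ultra_class 0 by rewrite /ultra_class !piE.
apply/ultra_classP/null_predP; rewrite subr0 -x0.
exact: ultra_norm_cvg.
Qed.

HB.instance Definition _ := Lmodule_isNormed.Build R ultrapower
  ultra_normD ultra_normZ ultra_norm_eq0.

Lemma norm_ultra_class f : `|ultra_class f| = lim (`|f i| @[i --> U]).
Proof. exact: ultra_normE. Qed.

End Ultrapower.

Definition countably_incomplete {I : Type} (U : set_system I) : Prop :=
  exists2 A : nat -> set I, forall n, U (A n) & \bigcap_n A n = set0.

Section Octahedral.
Context {R : realType} (A B : Type) (X : normedModType R).

(* (l_infty(|A|), |B|)-octahedrality; [linfty S R^o] is l_infty(|S|). *)
Definition linfty_octahedral : Prop :=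
  forall Z : set X, card_lt Z B ->
  forall S : Type, card_lt S A ->
  forall eps : R, 0 < eps ->
  exists phi : {linear linfty S R^o -> X}, (opnorm phi <= 1)%E /\
    forall (z : X) (y : linfty S R^o), Z z ->
      (1 - eps) * (`|z| + `|y|) <= `|z + phi y|.

Definition linfty_rigid_octahedral : Prop :=
  forall Z : set X, card_lt Z B ->
  forall S : Type, card_lt S A ->
  exists phi : {linear linfty S R^o -> X}, (opnorm phi <= 1)%E /\
    forall (z : X) (y : linfty S R^o), Z z -> `|z + phi y| = `|z| + `|y|.

End Octahedral.

(* Main.v *)
(** A countably incomplete ultrafilter carries a function [nu : I -> nat] that
    tends to infinity. A set of cardinality less than omega_1 is an increasing
    union of finite sets [S_n]. For each [i], octahedrality of [X], applied to
    the [i]-th coordinates of [Z], to [S_(nu i)] and to [eps = 1 / (nu i + 1)],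
    gives [phi_i]; the ultraproduct of the maps [y |-> phi_i (y | S_(nu i))] is
    the required operator, since the sup of [|y|] over [S_(nu i)] tends to
    [|y|]. *)

Require Import Defs.
From HB Require Import structures.
From mathcomp Require Import all_boot all_order all_algebra.
From mathcomp Require Import all_classical all_reals all_analysis.
Import numFieldNormedType.Exports.
Local Open Scope classical_set_scope.
Local Open Scope ring_scope.

Import Order.TTheory GRing.Theory Num.Theory.

Lemma opnorm_le1P (R : realType) (V W : normedModType R)
    (phi : {linear V -> W}) :
  (opnorm phi <= 1)%E <-> forall x, `|phi x| <= `|x|.
Proof.
split=> [phi1 x|phi1]; last first.
  by apply: ge_ereal_sup => _ [x x1 <-]; rewrite lee_fin (le_trans (phi1 x)).
have [->|x0] := eqVneq x 0; first by rewrite linear0 normr0.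
have x_gt0 : 0 < `|x| by rewrite normr_gt0.
have : (`|phi (`|x|^-1 *: x)|%:E <= 1)%E.
  apply: le_trans phi1; apply: ereal_sup_ubound.
  by exists (`|x|^-1 *: x) => //=; rewrite normrZ normfV normr_id mulVf ?gt_eqF.
by rewrite lee_fin linearZ normrZ normfV normr_id ler_pdivrMl// mulr1.
Qed.

(** Take for [nu i] the least [n] with [i] outside [A n]; one exists because the intersection is
    empty. Then [nu i >= m] once [i] lies in [A 0], ..., [A (m - 1)], a finite intersection of
    members of [U]. *)
Lemma countably_incomplete_unbounded {I : Type} (U : set_system I)
    (UF : Filter U) : countably_incomplete U ->
  exists nu : I -> nat, nu i @[i --> U] --> \oo.
Proof.
move=> [A UA A0].
have exit i : exists n, `[< ~ A n i >].
  apply: contrapT => Ai; have : (\bigcap_n A n) i.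
    by move=> n _; apply: contrapT => An; apply: Ai; exists n; apply/asboolP.
  by rewrite A0.
exists (fun i => ex_minn (exit i)).
suff nu_ge m : \forall i \near U, (m <= ex_minn (exit i))%N.
  by move=> P [m _ mP]; apply: filterS (nu_ge m) => i; exact: mP.
have : \forall i \near U, forall k, (k < m)%N -> A k i.
  elim: m => [|m IHm]; first by apply: nearW.
  apply: filterS2 IHm (UA m) => i Ai Ami k.
  by rewrite ltnS leq_eqVlt => /predU1P[->//|]; exact: Ai.
apply: filterS => i Ai; case: ex_minnP => n /asboolP An _.
by rewrite leqNgt; apply/negP => /Ai.
Qed.

(** If [S] did not inject into [nat], it would be strictly larger than [nat], so the successor
    [omega1] would embed in [S]. *)
Lemma card_lt_omega1 (S : Type) :
  card_lt S omega1 -> exists e : S -> nat, injective e.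
Proof.
move=> [_ NS]; suff /pcard_injP[e einj] : ([set: S] #<= [set: nat])%card.
  by exists e => x y; apply: einj; rewrite inE.
apply: contrapT => Snat; apply: NS; apply: (proj2 omega1P); split=> //.
by apply/infiniteP => /finite_set_countable.
Qed.

Lemma card_lt_finite (T : Type) (A : set T) : finite_set A -> card_lt A nat.
Proof.
move=> Af; rewrite /card_lt (card_le_eql (card_setT A)).
rewrite (card_le_eqr (card_setT A)); split; first exact: finite_set_countable.
by move=> /card_le_finite/(_ Af); exact: infinite_nat.
Qed.

Lemma card_lt_image (T T' B : Type) (f : T -> T') (A : set T) :
  card_lt A B -> card_lt (f @` A) B.
Proof.
rewrite /card_lt !(card_le_eql (card_setT _)) !(card_le_eqr (card_setT _)).
move=> [AB NBA]; split; first exact: card_le_trans (card_image_le f A) AB.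
by move=> BfA; apply: NBA; exact: card_le_trans BfA (card_image_le f A).
Qed.

Section Precomposition.
Context {R : realType} {S T : Type} {V : normedModType R} (e : T -> S).

Fact linfty_comp_bounded (y : linfty S V) : (y \o e) \in @bounded_pred R T V.
Proof.
by apply/bounded_predP; exists `|y| => t; exact: linfty_norm_ub.
Qed.

(** For [e := set_val] this is restriction to a subset. *)
Definition linfty_comp (y : linfty S V) : linfty T V :=
  Linfty (linfty_comp_bounded y).

Fact linfty_comp_is_linear : linear linfty_comp.
Proof. by move=> k x y; exact: val_inj. Qed.

HB.instance Definition _ :=
  GRing.isLinear.Build R (linfty S V) (linfty T V) _ linfty_comp
    linfty_comp_is_linear.

Lemma ler_norm_linfty_comp y : `|linfty_comp y| <= `|y|.
Proof. by apply: linfty_norm_le => // t; exact: (linfty_norm_ub y (e t)). Qed.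

End Precomposition.

Section UltrapowerMap.
Context {R : realType} {V X : normedModType R} {I : Type} {U : set_system I}.
Context (UU : UltraFilter U) (psi : I -> {linear V -> X}).
Hypothesis psi_le : forall i v, `|psi i v| <= `|v|.

(** The bound [psi_le] is uniform in [i], so the values [psi i v] form a bounded family and have a
    class in the ultrapower. *)
Fact ultra_map_bounded v : (psi^~ v) \in @bounded_pred R I X.
Proof. by apply/bounded_predP; exists `|v|. Qed.

Definition ultra_map (v : V) : ultrapower X UU :=
  ultra_class UU (Linfty (ultra_map_bounded v)).

Fact ultra_map_is_linear : linear ultra_map.
Proof.
move=> k x y; rewrite -[k *: ultra_map x]/(ultra_scale k (ultra_map x)).
rewrite /ultra_map ultra_scaleE -ultra_classD; congr ultra_class.
by apply/val_inj/funext => i /=; rewrite linearP.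
Qed.

HB.instance Definition _ :=
  GRing.isLinear.Build R V (ultrapower X UU) _ ultra_map ultra_map_is_linear.

End UltrapowerMap.

(** A point [s] where [y] nearly attains its norm belongs to every sublevel set with [n > e s]. *)
Lemma linfty_norm_cvg (R : realType) (S : Type) (V : normedModType R)
    (e : S -> nat) (y : linfty S V) :
  `|linfty_comp (@set_val _ [set s | (e s < n)%N]) y| @[n --> \oo] --> `|y|.
Proof.
apply/cvgrPdist_le => d d0.
suff [m ym] : exists m, forall n, (m <= n)%N ->
    `|y| - d <= `|linfty_comp (@set_val _ [set s | (e s < n)%N]) y|.
  exists m => // n /= /ym yn; rewrite ger0_norm ?subr_ge0.
    by rewrite lerBlDr addrC -lerBlDr.
  exact: ler_norm_linfty_comp.
(* The first case covers an empty [S], where no point can nearly attain the norm. *)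
have [y0|y_gt] := lerP (`|y| - d) 0.
  by exists 0%N => n _; exact: le_trans y0 _.
have [[s ys]|Ns] := pselect (exists s, `|y| - d <= `|y s|).
  exists (e s).+1 => n en; apply: le_trans ys _.
  have sP : s \in [set s | (e s < n)%N] by rewrite inE.
  exact: (linfty_norm_ub (linfty_comp set_val y) (SigSub sP)).
have : `|y| <= `|y| - d.
  apply: linfty_norm_le; first exact: ltW.
  by move=> s; rewrite leNgt; apply/negP => /ltW ys; apply: Ns; exists s.
by rewrite lerBrDr gerDl leNgt d0.
Qed.

Theorem theorem5p1 (R : realType) (X : completeNormedModType R)
    (K : Type) (K_infinite : infinite_set [set: K])
    (X_oct : linfty_octahedral nat K X)
    (I : Type) (I_infinite : infinite_set [set: I])
    (U : set_system I) (UU : UltraFilter U)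
    (U_incomplete : countably_incomplete U) :
  linfty_rigid_octahedral omega1 K (ultrapower X UU).
Proof.
move=> Z ZK S /card_lt_omega1[e e_inj].
have [nu nu_oo] := countably_incomplete_unbounded U _ U_incomplete.
pose Sn n := [set s | (e s < n)%N].
(* With one representative fixed per class, the [i]-th coordinates of [Z] form an image of [Z],
   still of cardinality below [K]. *)
pose rep (z : ultrapower X UU) : linfty I X := repr z.
have repE z : z = ultra_class UU (rep z) by rewrite /ultra_class reprK.
(* Injectivity of [e] makes [Sn n] finite, as octahedrality at omega_0 demands. *)
have Sn_lt n : card_lt (Sn n) nat.
  apply: card_lt_finite; apply: (finite_preimage _ (finite_II n)).
  by move=> x y _ _; exact: e_inj.
(* This epsilon is [harmonic (nu i)]: positive even when [nu i = 0], and tending to 0 along [U]. *)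
have oct i : {phi : {linear linfty (Sn (nu i)) R^o -> X} |
    (opnorm phi <= 1)%E /\ forall z y, Z z ->
    (1 - (nu i).+1%:R^-1) * (`|rep z i| + `|y|) <= `|rep z i + phi y|}.
  apply: cid; have Zi := card_lt_image _ _ _ (fun z => rep z i) _ ZK.
  have [|phi [phi1 phiP]] :=
    X_oct _ Zi (Sn (nu i)) (Sn_lt _) (nu i).+1%:R^-1; first by rewrite invr_gt0.
  by exists phi; split=> // z y Zz; apply: phiP; exists z.
pose res i : {linear linfty S R^o -> linfty (Sn (nu i)) R^o} :=
  linfty_comp set_val.
pose psi i : {linear linfty S R^o -> X} := sval (oct i) \o res i.
have psi_le i y : `|psi i y| <= `|y|.
  have /opnorm_le1P phi1 := (svalP (oct i)).1.
  exact: le_trans (phi1 _) (ler_norm_linfty_comp _ _).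
pose Phi : {linear linfty S R^o -> ultrapower X UU} := ultra_map UU psi psi_le.
have Phi_le y : `|Phi y| <= `|y|.
  rewrite norm_ultra_class; apply: limr_le; first exact: ultra_norm_cvg.
  by apply: nearW => i; exact: psi_le.
exists Phi; split; first exact/opnorm_le1P.
move=> z y Zz; apply/eqP; rewrite eq_le; apply/andP; split.
  by rewrite (le_trans (ler_normD _ _))// lerD2l.
(* The reverse inequality compares two limits along [U] of coordinatewise norms. *)
rewrite [z in leRHS]repE -ultra_classD norm_ultra_class.
rewrite [z in leLHS]repE norm_ultra_class.
set f := rep z + _.
have lb_cvg : (1 - harmonic (nu i)) * (`|rep z i| + `|res i y|) @[i --> U] -->
    (1 - 0) * (lim (`|rep z i| @[i --> U]) + `|y|).
  apply: cvgM.
    apply: cvgB; first exact: cvg_cst.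
    exact: (cvg_comp _ _ nu_oo (@cvg_harmonic R)).
  apply: cvgD; first exact: ultra_norm_cvg.
  exact: (cvg_comp _ _ nu_oo (linfty_norm_cvg _ _ _ e y)).
(* By the choice of the maps in [oct], the gap between the norm of [f i] and its lower bound is
   nonnegative for every [i], hence so is its limit. *)
rewrite subr0 mul1r in lb_cvg; rewrite -subr_ge0.
have gap_cvg := cvgB (@ultra_norm_cvg R X I U UU f) lb_cvg.
apply: (cvgr_to_ge (gap_cvg _)).
by apply: nearW => i; rewrite subr_ge0; exact: (svalP (oct i)).2.
Qed.
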